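(* Let $n \geq 3$ be an integer. There exist $n-1$ edge-disjoint spanning trees in the $n$-dimensional augmented cube $AQ_n$.
   Context: The $n$-dimensional augmented cube $AQ_n$ ($n\ge 1$) is the graph on $2^n$ vertices labeled by $n$-bit binary strings $u=u_1u_2\cdots u_n$, defined recursively: $AQ_1$ is $K_2$ on vertex set $\{0,1\}$. For $n\ge 2$, $AQ_n$ consists of two copies $AQ^0_{n-1}$ (vertices $0u_2\cdots u_n$) and $AQ^1_{n-1}$ (vertices $1v_2\cdots v_n$) of $AQ_{n-1}$ (with the first bit prepended), together with $2^n$ additional edges: a vertex $u=0u_2\cdots u_n$ is joined to $v=1v_2\cdots v_n$ if and only if either $u_i=v_i$ for all $2\le i\le n$ (a hypercube edge), or $u_i=\overline{v_i}$ for all $2\le i\le n$ (a complement edge). A spanning tree of a graph $G$ is a tree $T\subseteq G$ with $V(T)=V(G)$; spanning trees $T_1,\dots,T_k$ are edge-disjoint if their edge sets are pairwise disjoint. *)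

(* Defs.v *)
From mathcomp Require Import all_boot.

Set Implicit Arguments.
Unset Strict Implicit.
Unset Printing Implicit Defensive.

Record sgraph (V : finType) := SGraph {
  adj :> rel V;
  adj_sym : symmetric adj;
  adj_irr : irreflexive adj
}.

Definition edges (V : finType) (G : sgraph V) : {set {set V}} :=
  [set [set p.1; p.2] | p : V * V & G p.1 p.2].

Definition connected (V : finType) (G : sgraph V) : Prop :=
  forall x y : V, connect G x y.

(* Without the bound on the length, an edge traversed back and forth would
   count as a cycle. *)
Definition acyclic (V : finType) (G : sgraph V) : Prop :=
  forall c : seq V, 3 <= size c -> uniq c -> ~~ cycle G c.

Definition is_tree (V : finType) (G : sgraph V) : Prop :=
  [/\ 0 < #|V|, connected G & acyclic G].

(* T and G share the vertex type V, so T is automatically spanning. *)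
Definition spanning_tree (V : finType) (G T : sgraph V) : Prop :=
  edges T \subset edges G /\ is_tree T.

Definition edge_disjoint (V : finType) (G H : sgraph V) : Prop :=
  [disjoint edges G & edges H].

(* Strings are read from the left, the head being u_1. Only strings of equal
   positive length matter: the last clause is a junk value. *)
Fixpoint aq_adj (u v : seq bool) : bool :=
  match u, v with
  | [:: a], [:: b] => a != b
  | a :: u', b :: v' =>
      if a == b then aq_adj u' v' else (u' == v') || (u' == map negb v')
  | _, _ => false
  end.

Lemma aq_adj_sym : symmetric aq_adj.
Proof.
have neg_sym (s t : seq bool) : (s == map negb t) = (t == map negb s).
  by apply/eqP/eqP => ->; rewrite (mapK negbK).
elim=> [|a u IHu] [|b v] //=; [by case: v | by case: u {IHu} |].
rewrite (eq_sym b) (eq_sym v) (neg_sym v) -IHu.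
by case: u v {IHu} => [|a1 u] [|b1 v] //=.
Qed.

Lemma aq_adj_irr : irreflexive aq_adj.
Proof.
by elim=> [|a u IHu] //=; rewrite eqxx IHu; case: u {IHu}.
Qed.

Definition AQ (n : nat) : sgraph (n.-tuple bool) :=
  @SGraph (n.-tuple bool) (fun u v => aq_adj u v)
    (fun u v => aq_adj_sym u v) (fun u => aq_adj_irr u).

(* Main.v *)
Require Import Defs.
From mathcomp Require Import all_boot zify.

Set Implicit Arguments.
Unset Strict Implicit.
Unset Printing Implicit Defensive.

(* The graph AQ_n is 2(n-1)-edge-connected, by induction on n: if A splits both
   halves properly, add the two boundaries inside the halves; otherwise, up to
   complementing A, one half is disjoint from A, and each vertex of A in the
   other half contributes its two cross edges.

   A 2k-edge-connected graph has k edge-disjoint spanning trees (a special case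
   of the Nash-Williams-Tutte theorem).  Colour all edges with k colours so that
   the total number of components of the colour classes is minimal.  An edge is
   redundant if its ends stay connected in its own class without it; by
   minimality its ends are then connected in every class, so recolouring it
   keeps the colouring optimal.  Let R be the set of edges that become redundant
   after some sequence of such moves.  Then every colour class, restricted to R,
   has the same components as R, say p of them, and an edge between two of these
   components is a bridge of its class, so there are at most k(p-1) such edges.
   Each component of R has at least 2k boundary edges if p > 1, giving at least
   kp such edges: hence p = 1 and every colour class is connected. *)

(** * Connectivity and component counts for sets of edges *)

Section EdgeSets.

Variable V : finType.
Implicit Types (E F H : {set {set V}}) (e f : {set V}) (x y a b c d : V).

Lemma set2_inj a b c d :
  [set a; b] = [set c; d] -> (a = c /\ b = d) \/ (a = d /\ b = c).
Proof.
move/setP=> ab; move: (ab a) (ab b) (ab c) (ab d).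
rewrite !inE !eqxx ?orbT /= => /esym acd /esym bcd cab dab.
have [ac | nac] := eqVneq a c; last first.
  move: acd cab; rewrite (negPf nac) (eq_sym c a) (negPf nac) /=.
  by move=> /eqP-> /eqP->; right.
left; split=> //; have [//|nbd] := eqVneq b d.
move: bcd dab; rewrite (negPf nbd) (eq_sym d b) (negPf nbd) ac.
by rewrite !orbF => /eqP-> /eqP->.
Qed.

Definition edge_rel E : rel V := [rel x y | [set x; y] \in E].
Definition cn E := connect (edge_rel E).

Lemma cn_refl E x : cn E x x.
Proof. exact: connect0. Qed.

Lemma cn_sym E x y : cn E x y = cn E y x.
Proof. by apply: sym_connect_sym => u v; rewrite /edge_rel /= setUC. Qed.

Lemma cn_trans E : transitive (cn E).
Proof. exact: connect_trans. Qed.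

Lemma cnS E F x y : E \subset F -> cn E x y -> cn F x y.
Proof.
move=> /subsetP sEF; apply: connect_sub => u v uv.
exact/connect1/sEF.
Qed.

Lemma cn_edge E x y : [set x; y] \in E -> cn E x y.
Proof. by move=> xyE; apply: connect1. Qed.

Lemma cnU1 H c d x y : cn ([set c; d] |: H) x y ->
  [\/ cn H x y, cn H x c /\ cn H d y | cn H x d /\ cn H c y].
Proof.
move/connectP=> [p]; elim: p x => [|z p IHp] x /=.
  by move=> _ ->; constructor 1; apply: cn_refl.
move=> /andP[xz zp] /(IHp z zp) {IHp zp} zy.
have [xzH|xzH] := boolP ([set x; z] \in H).
  have xz' := cn_edge xzH.
  case: zy => [zy|[zc dy]|[zd cy]]; [constructor 1|constructor 2|constructor 3].
  - exact: cn_trans xz' zy.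
  - by split=> //; apply: cn_trans xz' zc.
  - by split=> //; apply: cn_trans xz' zd.
have {xz}: [set x; z] = [set c; d].
  by move: xz; rewrite /edge_rel /= in_setU1 (negPf xzH) orbF => /eqP.
have r u : cn H u u by apply: cn_refl.
case/set2_inj=> -[? ?]; subst x z; case: zy => [zy|[zc dy]|[zd cy]].
- by constructor 2.
- by constructor 2.
- by constructor 1.
- by constructor 3.
- by constructor 1.
- by constructor 3.
Qed.

(* Holds vacuously when e is not of the form [set a; b]. *)
Definition spans F e := [forall a, forall b, (e == [set a; b]) ==> cn F a b].

Lemma spansP F a b : spans F [set a; b] = cn F a b.
Proof.
apply/idP/idP => [/forallP/(_ a)/forallP/(_ b)|ab]; first by rewrite eqxx.
apply/forallP=> x; apply/forallP=> y; apply/implyP=> /eqP xy.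
by case: (set2_inj xy) => -[<- <-] //; rewrite cn_sym.
Qed.

Lemma spansS E F e : E \subset F -> spans E e -> spans F e.
Proof.
move=> sEF /forallP Ee; apply/forallP=> a; apply/forallP=> b.
apply/implyP=> eab; move/forallP/(_ b)/implyP/(_ eab): (Ee a).
exact: cnS.
Qed.

Lemma spans_cn E F x y : {in E, forall e, spans F e} -> cn E x y -> cn F x y.
Proof. by move=> sEF; apply: connect_sub => u v /sEF; rewrite spansP. Qed.

Lemma spans_mem E e : e \in E -> spans E e.
Proof.
move=> eE; apply/forallP=> a; apply/forallP=> b; apply/implyP=> /eqP fab.
by apply: cn_edge; rewrite -fab.
Qed.

(** A path from [a] to [b] has to use the edge [cd]; its remaining pieces, closed up by the edge
    [ab], join [c] to [d]. *)
Lemma spans_exchange H a b c d :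
  spans ([set c; d] |: H) [set a; b] -> ~~ spans H [set a; b] ->
  spans ([set a; b] |: H) [set c; d].
Proof.
rewrite !spansP => /cnU1 cdab nab.
have sH : H \subset [set a; b] |: H by apply: subsetUr.
have ab : cn ([set a; b] |: H) b a.
  by rewrite cn_sym; apply: cn_edge; rewrite setU11.
case: cdab => [abH|[ac db]|[ad cb]]; first by rewrite abH in nab.
  apply: cn_trans (cnS sH _) _; first by rewrite cn_sym; apply: ac.
  rewrite cn_sym; apply: cn_trans (cnS sH db) ab.
apply: cn_trans (cnS sH cb) _; apply: cn_trans ab (cnS sH ad).
Qed.

Definition component E x := [set y | cn E x y].
Definition components E := [set component E x | x : V].
Definition ncomp E := #|components E|.

Lemma componentP E x y : reflect (component E x = component E y) (cn E x y).
Proof.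
apply: (iffP idP) => [xy|/setP/(_ y)]; last by rewrite !inE cn_refl.
apply/setP=> z; rewrite !inE; apply/idP/idP; last exact: cn_trans.
by apply: cn_trans; rewrite cn_sym.
Qed.

Lemma ncomp_gt0 E : 0 < #|V| -> 0 < ncomp E.
Proof.
case/card_gt0P=> x _; apply/card_gt0P; exists (component E x).
exact: imset_f.
Qed.

(** When [E \subset F], this sends a component of [E] to the component of [F] containing it. The map
    is onto, and not injective as soon as two components get joined. *)
Definition merge_set F (C : {set V}) := \bigcup_(z in C) component F z.

Lemma merge_component E F x : E \subset F ->
  merge_set F (component E x) = component F x.
Proof.
move=> sEF; apply/setP=> y; apply/bigcupP/idP => [[z]|xy].
  rewrite !inE => xz; apply: cn_trans; exact: cnS xz.
by exists x => //; rewrite inE cn_refl.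
Qed.

Lemma components_merge E F : E \subset F ->
  components F = merge_set F @: components E.
Proof.
move=> sEF; rewrite /components -imset_comp; apply: eq_imset => x /=.
by rewrite merge_component.
Qed.

Lemma ncompS E F : E \subset F -> ncomp F <= ncomp E.
Proof. by move=> /components_merge sEF; rewrite /ncomp sEF leq_imset_card. Qed.

Lemma ncompU1 E a b : ~~ cn E a b -> ncomp ([set a; b] |: E) < ncomp E.
Proof.
move=> nab; have sE : E \subset [set a; b] |: E by apply: subsetUr.
rewrite ltn_neqAle ncompS // andbT; apply: contra nab.
rewrite /ncomp (components_merge sE) => /imset_injP inj.
apply/componentP; apply: inj; rewrite ?imset_f // !merge_component //.
by apply/componentP/cn_edge/setU11.
Qed.

Lemma eq_ncomp E F : cn E =2 cn F -> ncomp E = ncomp F.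
Proof.
move=> EF; rewrite /ncomp /components; congr #|pred_of_set _|.
by apply: eq_imset => x; apply/setP=> y; rewrite !inE EF.
Qed.

Lemma spans_ncomp E e : spans E e -> ncomp (e |: E) = ncomp E.
Proof.
move=> Ee; apply: eq_ncomp => x y; apply/idP/idP; last first.
  by apply: cnS; apply: subsetUr.
by apply: spans_cn => f; rewrite in_setU1 => /predU1P[->//|/spans_mem].
Qed.

End EdgeSets.

(** * Optimal colourings and the edges that recolouring can release *)

Section Colourings.

Variables (V : finType) (E : {set {set V}}) (k : nat).
Hypothesis edgeP : {in E, forall e, exists a b, e = [set a; b]}.

Notation colouring := {ffun {set V} -> 'I_k}.
Implicit Types (col : colouring) (e f : {set V}) (i j : 'I_k).

Definition cclass col i := [set e in E | col e == i].
Definition recolour col e j : colouring :=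
  [ffun f => if f == e then j else col f].
Definition redundant col e := (e \in E) && spans (cclass col (col e) :\ e) e.
Definition step : rel colouring := [rel col col' |
  [exists e, exists j, redundant col e && (col' == recolour col e j)]].
Definition cost col := \sum_i ncomp (cclass col i).
Definition optimal col := forall col', cost col <= cost col'.

Lemma spans_edgeU1 F e f : e \in E -> f \in E ->
  spans (f |: F) e -> ~~ spans F e -> spans (e |: F) f.
Proof.
by move=> /edgeP[a [b ->]] /edgeP[c [d ->]]; apply: spans_exchange.
Qed.

Lemma ncomp_edgeU1 F e : e \in E -> ~~ spans F e -> ncomp (e |: F) < ncomp F.
Proof. by move=> /edgeP[a [b ->]]; rewrite spansP; apply: ncompU1. Qed.

Lemma cclassD1_recolour col e j i :
  cclass (recolour col e j) i :\ e = cclass col i :\ e.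
Proof.
apply/setP=> f; rewrite !inE ffunE.
by case: (f =P e).
Qed.

Lemma recolour_class col e j : e \in E ->
  cclass (recolour col e j) j = e |: (cclass col j :\ e).
Proof.
move=> eE; rewrite -(cclassD1_recolour col e j) setD1K //.
by rewrite inE eE ffunE eqxx /=.
Qed.

Lemma recolour_class_neq col e j i : i != j ->
  cclass (recolour col e j) i = cclass col i :\ e.
Proof.
move=> nij; rewrite -(cclassD1_recolour col e j).
apply/setP=> f; rewrite !inE ffunE; case: (f =P e) => //= _.
by rewrite eq_sym (negPf nij) andbF.
Qed.

Lemma cclassD1 col e i : i != col e -> cclass col i :\ e = cclass col i.
Proof.
move=> nie; apply/setP=> f; rewrite !inE; case: (f =P e) => //= ->.
by rewrite eq_sym (negPf nie) andbF.
Qed.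

Lemma redundant_ncomp col e : redundant col e ->
  ncomp (cclass col (col e) :\ e) = ncomp (cclass col (col e)).
Proof.
case/andP=> eE /spans_ncomp <-; rewrite setD1K //.
by rewrite inE eE eqxx.
Qed.

(** The class that loses [e] keeps its components, so only class [j] can change; there [e] merges
    two components unless its ends are already connected. *)
Lemma cost_recolour col e j : redundant col e ->
  cost (recolour col e j) <= cost col ?= iff spans (cclass col j :\ e) e.
Proof.
move=> red; have /andP[eE sp] := red.
rewrite /cost (bigD1 j) //= [in X in _ <= X ?= iff _](bigD1 j) //=.
have -> : \sum_(i < k | i != j) ncomp (cclass (recolour col e j) i) =
          \sum_(i < k | i != j) ncomp (cclass col i).
  apply: eq_bigr => i nij; rewrite recolour_class_neq //.
  have [->|nie] := eqVneq i (col e); first exact: redundant_ncomp.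
  by rewrite cclassD1.
rewrite recolour_class //.
have -> : ncomp (cclass col j) = ncomp (cclass col j :\ e).
  have [->|nie] := eqVneq j (col e); first by rewrite redundant_ncomp.
  by rewrite cclassD1.
have [sj|nsj] := boolP (spans _ _).
  by rewrite spans_ncomp //; apply/leqif_refl.
split; first by rewrite leq_add2r ltnW // ncomp_edgeU1.
by rewrite eqn_add2r ltn_eqF // ncomp_edgeU1.
Qed.

Lemma optimal_spans col e j : optimal col -> redundant col e ->
  spans (cclass col j :\ e) e.
Proof.
move=> opt red; have lec := cost_recolour j red.
by rewrite -lec eqn_leq lec opt.
Qed.

Lemma optimal_step col col' : step col col' -> optimal col -> optimal col'.
Proof.
case/existsP=> e /existsP[j /andP[red /eqP->]] opt c.
by apply: leq_trans (opt c); apply: cost_recolour.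
Qed.

Lemma step_ind col0 (P : colouring -> Prop) : P col0 ->
  (forall col col', connect step col0 col -> P col -> step col col' ->
     P col') ->
  forall col, connect step col0 col -> P col.
Proof.
move=> P0 PS col /connectP[p]; elim/last_ind: p col => [|p c IHp] col /=.
  by move=> _ ->.
rewrite rcons_path last_rcons => /andP[pp pc] ->.
have pl : connect step col0 (last col0 p) by apply/connectP; exists p.
exact: PS pl (IHp _ pp erefl) pc.
Qed.

Variable col0 : colouring.
Hypothesis opt0 : optimal col0.

Definition reachable := connect step col0.
Definition released := [set e | [exists col, reachable col && redundant col e]].

Lemma reachable_optimal col : reachable col -> optimal col.
Proof.
move: col; apply: step_ind => // col col' _ opt st.
exact: optimal_step st opt.
Qed.

Lemma redundant_spans col e i : reachable col -> redundant col e ->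
  spans (cclass col i :&: released :\ e) e.
Proof.
move=> rc red; have /andP[eE _] := red.
(* A minimal set P of edges of colour i spanning e is a path closing a cycle
   with e: once e gets colour i, every edge of P is redundant. *)
have [P /minsetP[sP minP] sPC] := minset_exists (P := [pred F | spans F e])
  (optimal_spans i (reachable_optimal rc) red).
apply: (spansS _ sP); apply/subsetP=> f fP.
have := subsetP sPC _ fP; rewrite in_setD1 => /andP[nfe fC].
have /andP[fE /eqP cfi] : (f \in E) && (col f == i) by move: fC; rewrite inE.
rewrite in_setD1 nfe in_setI fC /= inE; apply/existsP.
exists (recolour col e i); apply/andP; split.
  apply: connect_trans rc (connect1 _).
  by apply/existsP; exists e; apply/existsP; exists i; rewrite red /=.
rewrite /redundant fE ffunE (negPf nfe) cfi recolour_class //=.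
(* Since [P] minus [f] no longer spans [e], the exchange property shows that [e] together with the
   rest of [P] spans [f]. *)
have nsP : ~~ spans (P :\ f) e.
  apply/negP=> sPf; have := minP _ sPf (subD1set _ _).
  by move/setP/(_ f); rewrite fP !inE eqxx.
have /spansS : e |: P :\ f \subset (e |: cclass col i :\ e) :\ f.
  apply/subsetP=> g; rewrite !in_setU1 !in_setD1 in_setU1.
  case/predU1P=> [->|/andP[-> gP]]; first by rewrite eq_sym nfe eqxx.
  by rewrite (subsetP sPC _ gP) orbT.
apply; apply: spans_edgeU1 => //.
by rewrite setD1K.
Qed.

Lemma released_step col col' i : reachable col -> step col col' ->
  cn (cclass col' i :&: released) =2 cn (cclass col i :&: released).
Proof.
move=> rc /existsP[e /existsP[j /andP[red /eqP->]]].
(* Both sets differ from K by at most the edge e, which K spans. *)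
set K := cclass col i :&: released :\ e.
have sK : spans K e by apply: redundant_spans.
suff eqK H : H :\ e = K -> cn H =2 cn K.
  move=> x y; rewrite !eqK //.
  by rewrite -setIDAC cclassD1_recolour setIDAC.
move=> HK x y; apply/idP/idP; last by apply: cnS; rewrite -HK subD1set.
apply: spans_cn => f fH; have [->//|nfe] := eqVneq f e.
by apply: spans_mem; rewrite -HK in_setD1 nfe.
Qed.

(** A released edge is spanned by the released part of class [i] in the colouring where it is
    redundant, and moves from [col0] leave the connectivity of that part unchanged. *)
Lemma released_cclass i : cn (cclass col0 i :&: released) =2 cn released.
Proof.
move=> x y; apply/idP/idP; first by apply: cnS; apply: subsetIr.
apply: spans_cn => e; rewrite inE => /existsP[col /andP[rc red]].
have [a [b eab]] : exists a b, e = [set a; b].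
  by apply: edgeP; case/andP: red.
have : spans (cclass col i :&: released) e.
  exact: spansS (subD1set _ _) (redundant_spans i rc red).
rewrite eab !spansP; suff -> : cn (cclass col i :&: released) a b =
   cn (cclass col0 i :&: released) a b by [].
move: col rc {red}; apply: step_ind => // col col' rc <- st.
exact: released_step.
Qed.

Definition crossing := [set e in E | ~~ spans released e].

(** The edges of [Y] are added one at a time. Each joins two components: otherwise it would be
    redundant in [col0], hence released, hence not crossing. *)
Lemma card_crossing_class i (Y : {set {set V}}) :
  Y \subset cclass col0 i :&: crossing ->
  ncomp (cclass col0 i :&: released :|: Y) + #|Y| <= ncomp released.
Proof.
have [m] := ubnP #|Y|; elim: m Y => // m IHm Y leYm sY.
have [->|[e eY]] := set_0Vmem Y.
  by rewrite setU0 cards0 addn0 (eq_ncomp (released_cclass i)).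
have := subsetP sY _ eY; rewrite !inE => /andP[/andP[eE /eqP ei] /andP[_ nse]].
have ltY : #|Y :\ e| < #|Y| by rewrite (cardsD1 e Y) eY.
have := IHm (Y :\ e) (leq_trans ltY leYm) (subset_trans (subD1set _ _) sY).
apply: leq_trans.
have -> : cclass col0 i :&: released :|: Y =
   e |: (cclass col0 i :&: released :|: Y :\ e).
  by rewrite setUCA setD1K.
rewrite (cardsD1 e Y) eY addnA leq_add2r addn1.
apply: ncomp_edgeU1 => //; apply/negP=> se.
have eR : e \in released.
  rewrite inE; apply/existsP; exists col0; rewrite /reachable connect0 /=.
  rewrite /redundant eE; apply: spansS se.
  rewrite subUset; apply/andP; split; apply/subsetP=> f; last first.
    rewrite !in_setD1 ei => /andP[-> fY].
    by have := subsetP sY _ fY; rewrite inE => /andP[->].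
  rewrite in_setI in_setD1 ei => /andP[-> fR]; rewrite andbT.
  by apply: contraNneq nse => <-; apply: spans_mem.
by rewrite spans_mem in nse.
Qed.

Lemma card_crossing : 0 < #|V| -> #|crossing| <= k * (ncomp released).-1.
Proof.
move=> V0.
have -> : #|crossing| = \sum_i #|cclass col0 i :&: crossing|.
  rewrite -sum1_card (partition_big col0 xpredT) //=.
  apply: eq_bigr => i _; rewrite -sum1_card; apply: eq_bigl => e.
  by rewrite !inE; case: (e \in E) => //=; rewrite andbC.
rewrite -[k in k * _]card_ord -sum_nat_const; apply: leq_sum => i _.
(* At least one component remains after all crossing edges are added, which accounts for the
   predecessor. *)
have := card_crossing_class (subxx (cclass col0 i :&: crossing)).
have := ncomp_gt0
  (cclass col0 i :&: released :|: cclass col0 i :&: crossing) V0.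
lia.
Qed.

End Colourings.

(** * From large edge boundaries to edge-disjoint spanning trees *)

Section Packing.

Variable V : finType.
Implicit Types (G : sgraph V) (A : {set V}) (F R : {set {set V}}).

Definition boundary (e : rel V) A : {set V * V} :=
  [set p | [&& p.1 \in A, p.2 \notin A & e p.1 p.2]].

Lemma mem_edges G x y : ([set x; y] \in edges G) = G x y.
Proof.
apply/imsetP/idP => [[[a b] /=]|xy]; last by exists (x, y); rewrite ?inE.
by rewrite inE /= => ab /set2_inj[] [-> ->] //; rewrite adj_sym.
Qed.

Lemma edgesP G : {in edges G, forall e, exists a b, e = [set a; b]}.
Proof. by move=> _ /imsetP[[a b] _ ->]; exists a, b. Qed.

Lemma card_pairs_edges (X : {set V * V}) F :
  {in X, forall p, [set p.1; p.2] \in F} -> #|X| <= #|F| * 2.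
Proof.
move=> XF; rewrite -sum1_card.
rewrite (partition_big (fun p => [set p.1; p.2]) (mem F)) //=.
rewrite -sum_nat_const; apply: leq_sum => e _; rewrite sum1_card.
have [[a b] pab|noX] := pickP [pred p | (p \in X) && ([set p.1; p.2] == e)].
  apply: leq_trans (_ : #|[set (a, b); (b, a)]| <= 2); last first.
    by rewrite cards2; case: eqP.
  apply/subset_leq_card/subsetP=> -[c d]; move: pab => /= /andP[_ /eqP<-].
  rewrite unfold_in /= => /andP[_ /eqP/set2_inj[] [-> ->]]; rewrite !inE;
  by rewrite !eqxx ?orbT.
by rewrite eq_card0 // => p; apply: noX.
Qed.

(** Adjacent ordered pairs with ends in different components are sorted by the component of their
    first entry; the factor 2 counts the orientations of an edge. *)
Lemma sum_boundary_components G R :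
  \sum_(C in components R) #|boundary G C| <=
  #|[set e in edges G | ~~ spans R e]| * 2.
Proof.
set X := [set p : V * V | G p.1 p.2 && ~~ cn R p.1 p.2].
have <- : #|X| = \sum_(C in components R) #|boundary G C|.
  rewrite -sum1_card (partition_big (fun p => component R p.1)
    (mem (components R))) /=; last by move=> p _; apply: imset_f.
  apply: eq_bigr => _ /imsetP[x _ ->]; rewrite -sum1_card; apply: eq_bigl => p.
  have -> : (component R p.1 == component R x) = cn R x p.1.
    by rewrite cn_sym; apply/eqP/idP => /componentP.
  rewrite !inE andbC; have [xp|//] := boolP (cn R x p.1).
  suff -> : cn R p.1 p.2 = cn R x p.2 by rewrite /= andbC.
  by apply/idP/idP; apply: cn_trans; rewrite // cn_sym.
apply: card_pairs_edges => -[x y] /=; rewrite !inE /= => /andP[xy nxy].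
by rewrite mem_edges xy spansP.
Qed.

(** Writing the number of colours as [k.+1] provides the colour [ord0], so some colouring has least
    cost. *)
Lemma connect_boundary_packing G k : 0 < #|V| ->
  (forall A, A != set0 -> A != setT -> k.+1 * 2 <= #|boundary G A|) ->
  exists col : {ffun {set V} -> 'I_k.+1},
    forall i x y, cn (cclass (edges G) col i) x y.
Proof.
move=> V0 cut; pose E := edges G.
have [col _ minc] := arg_minnP (@cost V E k.+1) (isT : xpredT [ffun=> ord0]).
have opt : optimal E col by move=> c; apply: minc.
exists col => i x y.
set R := released E col.
suff Rxy : cn R x y.
  have := released_cclass (@edgesP G) opt i x y; rewrite Rxy.
  by apply: cnS; apply: subsetIl.
have [//|nxy] := boolP (cn R x y).
have lo : ncomp R * (k.+1 * 2) <= \sum_(C in components R) #|boundary G C|.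
  rewrite -sum_nat_const; apply: leq_sum => _ /imsetP[z _ ->].
  apply: cut; first by apply/set0Pn; exists z; rewrite inE cn_refl.
  apply: contraNneq nxy => /setP zT; apply: (@cn_trans _ _ z).
    by have := zT x; rewrite !inE cn_sym.
  by have := zT y; rewrite !inE.
have := card_crossing (@edgesP G) opt V0.
have := sum_boundary_components G R.
have := ncomp_gt0 R V0.
rewrite /crossing -/R -/E.
(* With [p.+1] components there would be at least [k.+1 * p.+1] crossing edges, but at most
   [k.+1 * p] exist. *)
move: lo; case: (ncomp R) => //= p.
by move=> lo _ hi1 hi2; move: (leq_trans lo hi1); nia.
Qed.

(** No edge of the path contains [x], so none of them is [e]. *)
Lemma cn_path_avoid F (e : {set V}) x y s : x \in e -> x \notin y :: s ->
  path (edge_rel F) y s -> cn (F :\ e) y (last y s).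
Proof.
move=> xe; elim: s y => [|z s IHs] y; first by move=> _ _; apply: cn_refl.
rewrite inE negb_or => /andP[nxy xs] /= /andP[yz zs].
apply: cn_trans (IHs z xs zs); apply: cn_edge.
rewrite in_setD1 [_ \in F]yz andbT.
apply: contraTneq xe => <-; rewrite !inE negb_or nxy.
by move: xs; rewrite inE negb_or => /andP[].
Qed.

(** A minimal connecting subset of [F] has no cycle: the rest of a cycle would still join the ends
    of its first edge, which could then be deleted. *)
Lemma spanning_tree_of_connected G F : 0 < #|V| -> F \subset edges G ->
  (forall x y, cn F x y) ->
  exists T : sgraph V, spanning_tree G T /\ edges T \subset F.
Proof.
move=> V0 FG conF.
pose P := [pred H : {set {set V}} | [forall x, forall y, cn H x y]].
have PF : P F by apply/forallP=> x; apply/forallP=> y.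
have [H /minsetP[/forallP conH minH] HF] := minset_exists PF.
have irr : irreflexive (edge_rel H).
  move=> x; apply/negP=> /(subsetP HF)/(subsetP FG).
  by rewrite mem_edges adj_irr.
have sym : symmetric (edge_rel H) by move=> x y; rewrite /edge_rel /= setUC.
pose T := SGraph sym irr.
have eT : edges T \subset H.
  by apply/subsetP=> _ /imsetP[[a b] ab ->]; move: ab; rewrite inE.
exists T; split; last exact: subset_trans eT HF.
split; first by apply: subset_trans eT (subset_trans HF FG).
split=> //; first by move=> x y; have /forallP/(_ y) := conH x.
move=> [|x [|y s]] // sz uniqc; apply/negP=> /=.
(* Length at least 3 gives a last vertex [z] distinct from [x] and [y], so the closing edge [zx] is
   not the edge [xy]. *)
case/lastP: s sz uniqc => // s z _ /and3P[xs ys _] /andP[xy].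
rewrite -cats1 cat_path last_rcons /= andbT => /andP[yz zx].
set e := [set x; y].
have yzH : cn (H :\ e) y z.
  by have := cn_path_avoid (set21 x y) xs yz; rewrite last_rcons.
have zxH : cn (H :\ e) z x.
  apply: cn_edge; rewrite in_setD1 [_ \in H]zx andbT; apply/eqP=> /setP/(_ z).
  rewrite !inE eqxx /= => /esym/orP[]/eqP zE.
    by move: xs; rewrite -zE !inE mem_rcons mem_head orbT.
  by move: ys; rewrite -zE mem_rcons mem_head.
have He : H :\ e = H.
  apply: minH; last exact: subD1set.
  apply/forallP=> u; apply/forallP=> v; have /forallP/(_ v) := conH u.
  apply: spans_cn => f fH; have [->|nfe] := eqVneq f e.
    by rewrite spansP cn_sym; apply: cn_trans yzH zxH.
  by apply: spans_mem; rewrite in_setD1 nfe.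
by move: xy; rewrite /edge_rel /= -He !inE eqxx.
Qed.

Lemma tree_packing G k : 0 < #|V| ->
  (forall A, A != set0 -> A != setT -> k * 2 <= #|boundary G A|) ->
  exists T : 'I_k -> sgraph V,
    (forall i, spanning_tree G (T i)) /\
    (forall i j, i != j -> edge_disjoint (T i) (T j)).
Proof.
case: k => [|k] V0 cut; first by exists (fun=> G); split; case.
have [col conn] := connect_boundary_packing V0 cut.
have tree i : exists T : sgraph V,
    spanning_tree G T /\ edges T \subset cclass (edges G) col i.
  apply: spanning_tree_of_connected => //.
  by apply/subsetP=> e; rewrite inE => /andP[].
have [T treeT] := fin_all_exists tree.
exists T; split=> [i|i j nij]; first by case: (treeT i).
have [_ /subsetP Ti] := treeT i; have [_ /subsetP Tj] := treeT j.
apply/pred0P=> e /=; apply/andP=> -[/Ti + /Tj].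
rewrite !inE => /andP[_ /eqP ->] /andP[_ /eqP ij].
by rewrite ij eqxx in nij.
Qed.

End Packing.

(** Reversing pairs is a bijection. This reduces the case of a full half of the cube to that of an
    empty half. *)
Lemma boundaryC (V : finType) (G : sgraph V) (A : {set V}) :
  #|boundary G (~: A)| = #|boundary G A|.
Proof.
have inj : injective (fun p : V * V => (p.2, p.1)).
  by move=> [a b] [c d] [-> ->].
rewrite -(card_imset _ inj); congr #|pred_of_set _|.
apply/setP=> -[x y]; apply/imsetP/idP => [[[a b] + [-> ->]]|xy].
  by rewrite !inE /= negbK adj_sym => /and3P[-> -> ->].
exists (y, x) => //; move: xy.
by rewrite !inE /= negbK adj_sym => /and3P[-> -> ->].
Qed.

(** * Edge boundaries in the augmented cube *)

Section AugmentedCube.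

Variable n : nat.
Implicit Types (A : {set n.+1.-tuple bool}) (b : bool).

Definition slice A b : {set n.-tuple bool} :=
  [set t : n.-tuple bool | [tuple of b :: t] \in A].

Definition consp (c : bool * bool) (p : n.-tuple bool * n.-tuple bool) :=
  ([tuple of c.1 :: p.1], [tuple of c.2 :: p.2]).

Lemma card_pairs_cons (X : {set n.+1.-tuple bool * n.+1.-tuple bool}) :
  #|X| = \sum_c #|[set p | consp c p \in X]|.
Proof.
rewrite -sum1_card (partition_big (fun p => (thead p.1, thead p.2)) xpredT) //=.
apply: eq_bigr => c _; rewrite sum1_card.
have inj : injective (consp c) by move=> [s t] [u v] [] /val_inj-> /val_inj->.
rewrite -(card_imset _ inj); apply: eq_card => -[s t].
rewrite unfold_in /=; apply/andP/imsetP => [[stX /eqP cE]|[p]].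
  exists ([tuple of behead s], [tuple of behead t]).
    by rewrite inE /consp -cE /= -!tuple_eta.
  by rewrite /consp -cE /= -!tuple_eta.
rewrite inE => pX -[-> ->]; split=> // {pX}.
by rewrite !theadE; case: (c).
Qed.

Lemma slice_neq0 A : A != set0 -> exists b, slice A b != set0.
Proof.
case/set0Pn=> u; case/tupleP: u => b u uA.
by exists b; apply/set0Pn; exists u; rewrite inE.
Qed.

End AugmentedCube.

Lemma slice_boundary n (A : {set n.+2.-tuple bool}) b :
  [set p | consp (b, b) p \in boundary (AQ n.+2) A] =
  boundary (AQ n.+1) (slice A b).
Proof.
apply/setP=> -[u v]; rewrite !inE /=.
(* Exposing a second bit makes [aq_adj] reduce to its recursive clause rather than the one for
   single bits. *)
by case/tupleP: u => x u; case/tupleP: v => y v; rewrite /= eqxx.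
Qed.

Lemma slice_cross n (A : {set n.+2.-tuple bool}) b : slice A b = set0 ->
  #|slice A (~~ b)| * 2 <=
  #|[set p | consp (~~ b, b) p \in boundary (AQ n.+2) A]|.
Proof.
move=> Ab; have nbb : (~~ b == b) = false by case: (b).
set B := slice A (~~ b).
pose neg (u : n.+1.-tuple bool) := [tuple of map negb u].
have negK : involutive neg.
  by move=> u; apply: val_inj; rewrite /= mapK //; apply: negbK.
pose same := [set (u, u) | u in B]; pose comp := [set (u, neg u) | u in B].
have <- : #|same :|: comp| = #|B| * 2.
  rewrite cardsU !card_imset; [|by move=> u v []..].
  rewrite (_ : same :&: comp = set0) ?cards0 ?subn0 ?muln2 ?addnn //.
  (* A nonempty string differs from its complement in the first bit, so the two cross neighbours are
     distinct. *)
  apply/setP=> p; rewrite !inE; apply/andP=> -[/imsetP[u _ ->]] /imsetP[v _].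
  case/tupleP: v => x v [-> /(congr1 val)] /= [].
  by case: x.
have out (u : n.+1.-tuple bool) : [tuple of b :: u] \notin A.
  by move/setP/(_ u): Ab; rewrite !inE => ->.
apply/subset_leq_card/subsetP=> p /setUP[] /imsetP[u]; rewrite inE => uA ->;
  rewrite !inE /= uA out /=; case/tupleP: u {uA} => x u; rewrite /=.
  by rewrite nbb eqxx.
by rewrite nbb negbK (mapK negbK) eqxx orbT.
Qed.

(** The first bits sort the boundary pairs into four kinds; those from half [b] to half [~~ b] are
    dropped. *)
Lemma boundary_slices n (A : {set n.+2.-tuple bool}) b :
  #|boundary (AQ n.+1) (slice A b)| + #|boundary (AQ n.+1) (slice A (~~ b))| +
  #|[set p | consp (~~ b, b) p \in boundary (AQ n.+2) A]| <=
  #|boundary (AQ n.+2) A|.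
Proof.
rewrite [leqRHS]card_pairs_cons (bigD1 (b, b)) //= (bigD1 (~~ b, ~~ b)) /=.
  rewrite (bigD1 (~~ b, b)) /= ?slice_boundary ?addnA ?leq_addr //.
  by case: b.
by case: b.
Qed.

(** The [maxn 1] records that the single edge of [AQ 1] is cut, where [n * 2] is 0; the two halves
    of [AQ 2] then contribute the required 2. *)
Lemma boundary_AQ n (A : {set n.+1.-tuple bool}) : A != set0 -> A != setT ->
  maxn 1 (n * 2) <= #|boundary (AQ n.+1) A|.
Proof.
elim: n A => [|n IHn] A A0 AT.
  apply/card_gt0P; have [u uA] := set0Pn _ A0.
  have /set0Pn[v vA] : ~: A != set0.
    by apply: contraNneq AT => /(congr1 (@setC _)); rewrite setCK setC0 => ->.
  rewrite inE in vA; exists (u, v); rewrite !inE uA vA /=.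
  case/tupleP: u uA => a u; case/tupleP: v vA => b v.
  rewrite (tuple0 u) (tuple0 v) /= => nbA aA.
  by apply: contraNneq nbA => <-.
have half_empty (B : {set n.+2.-tuple bool}) b : B != set0 ->
    slice B b = set0 -> maxn 1 (n.+1 * 2) <= #|boundary (AQ n.+2) B|.
  move=> B0 Bb; apply: leq_trans (boundary_slices B b).
  have Bnb0 : slice B (~~ b) != set0.
    have [c] := slice_neq0 B0; have [->|] := eqVneq c (~~ b); first by [].
    by case: b c Bb => -[] Bb //; rewrite Bb eqxx.
  have := slice_cross Bb; have: 0 < #|slice B (~~ b)| by rewrite card_gt0.
  (* A full half has [2 ^ n.+1 * 2] cross pairs, which is enough alone; otherwise at least two cross
     pairs are added to the [n * 2] pairs inside the half. *)
  have [full|nfull] := eqVneq (slice B (~~ b)) setT.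
    rewrite full cardsT card_tuple card_bool; have := ltn_expl n.+1 (ltnSn 1).
    by lia.
  by have := IHn _ Bnb0 nfull; lia.
have AC0 : ~: A != set0.
  by apply: contraNneq AT => /(congr1 (@setC _)); rewrite setCK setC0 => ->.
have bound b : maxn 1 (n.+1 * 2) <= #|boundary (AQ n.+2) A| \/
    maxn 1 (n * 2) <= #|boundary (AQ n.+1) (slice A b)|.
  have [Ab0|Ab0] := eqVneq (slice A b) set0.
    by left; apply: half_empty Ab0.
  have [AbT|AbT] := eqVneq (slice A b) setT; last by right; apply: IHn.
  left; rewrite -boundaryC; apply: (half_empty _ b AC0).
  by apply/setP=> u; move/setP/(_ u): AbT; rewrite !inE => ->.
have [//|bt] := bound true; have [//|bf] := bound false.
apply: leq_trans (leq_trans (leq_addr _ _) (boundary_slices A true)).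
by apply: leq_trans (leq_add bt bf); lia.
Qed.

Theorem theorem1 (n : nat) (hn : 3 <= n) :
  exists T : 'I_(n - 1) -> sgraph (n.-tuple bool),
    (forall i : 'I_(n - 1), spanning_tree (AQ n) (T i)) /\
    (forall i j : 'I_(n - 1), i != j -> edge_disjoint (T i) (T j)).
Proof.
apply: tree_packing; first by rewrite card_tuple card_bool expn_gt0.
case: n hn => // n _ A A0 AT; rewrite subn1 /=.
exact: leq_trans (leq_maxr _ _) (boundary_AQ A0 AT).
Qed.
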